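(* For every integer $t \ge 1$, the number $bm_{\vec{\chi}}(t)$ (exists and) satisfies $$bm_{\vec{\chi}}(t) \le 2m_\chi(2t)-1,$$ and moreover $2m_\chi(2t)-1= O\left(t(\log\log t)^{6}\right)$ (as $t\to\infty$).
   Context: All graphs and digraphs are finite; undirected graphs are simple, digraphs have no loops and no parallel arcs, but may contain both arcs $(u,v)$ and $(v,u)$. For an undirected graph $G$, $\chi(G)$ is its chromatic number. For a digraph $D$, the dichromatic number $\vec{\chi}(D)$ is the minimum $k$ such that $V(D)$ can be colored with $k$ colors so that every color class induces an acyclic subdigraph (one without directed cycles; two opposite arcs between the same two vertices form a directed cycle of length 2). $K_t$ is the complete graph on $t$ vertices, and $\overleftrightarrow{K}_t$ is the digraph on $t$ vertices in which every two distinct vertices $u,v$ are joined by both arcs $(u,v)$ and $(v,u)$. An arc $(u,v)$ of a digraph $D$ is (butterfly-)contractible if $v$ is the only out-neighbor of $u$ in $D$ or $u$ is the only in-neighbor of $v$ in $D$. For such an arc $e$, $D/e$ is obtained from $D$ by merging $u$ and $v$ into one vertex and joining their in- and out-neighborhoods, ignoring parallel arcs and loops. A butterfly minor of $D$ is any digraph that can be obtained (up to isomorphism) from $D$ by repeatedly deleting arcs, deleting vertices, or contracting butterfly-contractible arcs (contractible in the current digraph). $m_\chi(t)$ is the least positive integer such that every undirected graph with chromatic number at least $m_\chi(t)$ contains $K_t$ as a minor (it is well known that $m_\chi(t)$ is finite for every $t\ge 1$). A theorem of Postle, which may be used, states $m_\chi(t)=O\left(t(\log\log t)^{6}\right)$.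 $bm_{\vec{\chi}}(t)$ is the least positive integer such that every digraph $D$ with $\vec{\chi}(D)\ge bm_{\vec{\chi}}(t)$ contains $\overleftrightarrow{K}_t$ as a butterfly minor. *)

(* Defs.v *)
From HB Require Import structures.
From mathcomp Require Import all_boot all_order all_algebra.
From mathcomp Require Import all_classical all_reals all_analysis.

Set Implicit Arguments.
Unset Strict Implicit.
Unset Printing Implicit Defensive.

Record sgraph := SGraph {
  svertex :> finType;
  sedge : rel svertex;
  sedge_sym : symmetric sedge;
  sedge_irrefl : irreflexive sedge }.

Record digraph := Digraph {
  dvertex :> finType;
  darc : rel dvertex;
  darc_irrefl : irreflexive darc }.

Definition colorable (G : sgraph) (k : nat) : Prop :=
  exists f : {ffun G -> 'I_k}, forall x y : G, sedge x y -> f x != f y.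

Lemma colorable_ex (G : sgraph) : exists k, `[< colorable G k >].
Proof.
exists #|G|; apply/asboolP; exists [ffun x => enum_rank x] => x y xy.
rewrite !ffunE (inj_eq enum_rank_inj).
by apply: contraTneq xy => ->; rewrite sedge_irrefl.
Qed.

Definition chromatic_number (G : sgraph) : nat := ex_minn (colorable_ex G).

Lemma complete_sym t : symmetric (fun i j : 'I_t => i != j).
Proof. by move=> i j; rewrite eq_sym. Qed.

Lemma neq_irrefl t : irreflexive (fun i j : 'I_t => i != j).
Proof. by move=> i; rewrite eqxx. Qed.

Definition complete_graph (t : nat) : sgraph :=
  SGraph (@complete_sym t) (@neq_irrefl t).

Definition connected_in (G : sgraph) (A : {set G}) : Prop :=
  A != finset.set0 /\
  {in A &, forall x y,
    connect (fun a b => [&& a \in A, b \in A & sedge a b]) x y}.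

(* H is a minor of G: G has pairwise disjoint connected branch sets, one per
   vertex of H, with an edge of G between the branch sets of any two adjacent
   vertices of H. *)
Definition graph_minor (H G : sgraph) : Prop :=
  exists B : H -> {set G},
    [/\ forall x, connected_in (B x),
        forall x y, x != y -> [disjoint B x & B y] &
        forall x y, sedge x y ->
          exists u v : G, [/\ u \in B x, v \in B y & sedge u v]].

Section Subdigraphs.
Variable D : digraph.

Section Induced.
Variable A : {set D}.
Definition induced_arc : rel {x : D | x \in A} :=
  fun x y => darc (val x) (val y).
Lemma induced_arc_irrefl : irreflexive induced_arc.
Proof. by move=> x; rewrite /induced_arc darc_irrefl. Qed.
Definition induced : digraph := Digraph induced_arc_irrefl.
End Induced.

Definition del_vertex (v : D) : digraph := induced [set~ v].

Section Arcs.
Variables u v : D.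

Definition del_arc_rel : rel D := fun x y => darc x y && ((x, y) != (u, v)).
Lemma del_arc_irrefl : irreflexive del_arc_rel.
Proof. by move=> x; rewrite /del_arc_rel darc_irrefl. Qed.
Definition del_arc : digraph := Digraph del_arc_irrefl.

Definition contractible : bool :=
  darc u v && ([forall w, darc u w ==> (w == v)] ||
               [forall w, darc w v ==> (w == u)]).

(* The vertex u of the contracted digraph stands for the merged vertex. *)
Definition merge (w : D) : D := if w == v then u else w.

Definition contract_rel : rel {x : D | x \in [set~ v]} := fun x y =>
  (x != y) && [exists a, exists b,
                 [&& merge a == val x, merge b == val y & darc a b]].
Lemma contract_irrefl : irreflexive contract_rel.
Proof. by move=> x; rewrite /contract_rel eqxx. Qed.
Definition contract : digraph := Digraph contract_irrefl.
End Arcs.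
End Subdigraphs.

(* [ucycle] holds of the duplicate-free sequences that are closed walks, in
   particular of [:: x; y] when x and y are joined by two opposite arcs. *)
Definition acyclic (D : digraph) : Prop :=
  forall c : seq D, ucycle (@darc D) c -> c = [::].

Definition dicolorable (D : digraph) (k : nat) : Prop :=
  exists f : {ffun D -> 'I_k},
    forall i : 'I_k, acyclic (induced (finset (fun x => f x == i))).

Lemma dicolorable_ex (D : digraph) : exists k, `[< dicolorable D k >].
Proof.
exists #|D|; apply/asboolP; exists [ffun x => enum_rank x] => i.
have eqA (x y : induced (finset (fun x => [ffun x => enum_rank x] x == i))) :
    x = y.
  apply: val_inj; apply: enum_rank_inj.
  have := valP x; have := valP y.
  by rewrite !inE !ffunE => /eqP -> /eqP ->.
case=> [//|x [|y c]] /andP[] /=.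
  by rewrite /induced_arc darc_irrefl.
by rewrite (eqA y x) inE eqxx.
Qed.

Definition dichromatic_number (D : digraph) : nat := ex_minn (dicolorable_ex D).

Definition complete_digraph (t : nat) : digraph := Digraph (@neq_irrefl t).

Definition digraph_iso (D H : digraph) : Prop :=
  exists2 f : D -> H, bijective f & forall x y, darc (f x) (f y) = darc x y.

Inductive butterfly_minor (H : digraph) : digraph -> Prop :=
| BM_iso (D : digraph) : digraph_iso D H -> butterfly_minor H D
| BM_del_arc (D : digraph) (u v : D) :
    darc u v -> butterfly_minor H (del_arc u v) -> butterfly_minor H D
| BM_del_vertex (D : digraph) (v : D) :
    butterfly_minor H (del_vertex v) -> butterfly_minor H D
| BM_contract (D : digraph) (u v : D) :
    contractible u v -> butterfly_minor H (contract u v) ->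
    butterfly_minor H D.

Definition least_positive (P : nat -> Prop) (m : nat) : Prop :=
  [/\ 0 < m, P m & forall k, 0 < k -> P k -> m <= k].

Definition forces_minor (t m : nat) : Prop :=
  forall G : sgraph,
    m <= chromatic_number G -> graph_minor (complete_graph t) G.

Definition forces_butterfly_minor (t m : nat) : Prop :=
  forall D : digraph,
    m <= dichromatic_number D -> butterfly_minor (complete_digraph t) D.

(* The least positive integers of the definitions; the value 0 would mean that
   no such integer exists. *)
Definition m_chi (t : nat) : nat := xget 0 (least_positive (forces_minor t)).

Definition bm_dichi (t : nat) : nat :=
  xget 0 (least_positive (forces_butterfly_minor t)).

(* Main.v *)
(* Choose greedily X_1, X_2, ... where X_i is a maximal strongly connected
   2-dicolourable set in what remains of the digraph D, and join two parts by an
   edge when there are arcs between them in both directions. A union of pairwise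
   non-adjacent parts is 2-dicolourable: no path leaves X_i through later parts
   and comes back, for a shortest such path, coloured alternately, could be added
   to X_i. Hence the chromatic number of the graph of parts is at least half the
   dichromatic number of D, and a K_2t minor of it yields 2t disjoint strongly
   connected sets of D with arcs in both directions between any two. Pair them
   up as (A_i, B_i), and keep an arc a_i -> b_i, a spanning in-tree of A_i with
   root a_i, a spanning out-tree of B_i with root b_i and the arcs from B_i to
   A_j for i <> j: all arcs inside A_i and B_i and a_i -> b_i are contractible,
   and contracting them leaves the complete digraph.
   That m_chi is finite follows from breadth-first layers: one layer has at
   least half the chromatic number, and the union of the layers before it is a
   further branch set. *)
Require Import Defs.
From mathcomp Require Import all_boot all_order all_algebra.
From mathcomp Require Import all_classical all_reals all_analysis.
From mathcomp Require Import zify lra.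
Import numFieldNormedType.Exports.

Set Implicit Arguments.
Unset Strict Implicit.
Unset Printing Implicit Defensive.

(** * Clique minors of graphs of large chromatic number *)

Definition restrict (T : finType) (A : pred T) (e : rel T) : rel T :=
  fun a b => [&& A a, A b & e a b].

Lemma connect_homo (T T' : finType) (e : rel T) (e' : rel T') (m : T -> T') :
    (forall a b, e a b -> connect e' (m a) (m b)) ->
  forall x y, connect e x y -> connect e' (m x) (m y).
Proof.
move=> em x y /connectP[p ep ->]; elim: p x ep => [|z p IHp] x /=.
  by rewrite connect0.
by case/andP=> /em xz /IHp; apply: connect_trans.
Qed.

Lemma connect_invariant (T : finType) (e : rel T) (P : T -> Prop) :
    (forall a b, e a b -> P a -> P b) ->
  forall x y, connect e x y -> P x -> P y.
Proof.
move=> eP x y /connectP[p ep ->]; elim: p x ep => [//|z p IHp] x /=.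
by case/andP=> /eP xz /IHp IH /xz.
Qed.

(** Least length of a walk from [r]; unreachable vertices get the default [0], so all clauses speak
    of reachable ones. The last clause yields parents in a breadth-first tree. *)
Lemma distance_exists (T : finType) (e : rel T) (r : T) :
  exists d : T -> nat,
    [/\ d r = 0,
        forall x y, connect e r x -> e x y -> d y <= (d x).+1 &
        forall y, connect e r y -> y != r ->
          exists x, [/\ connect e r x, e x y & d y = (d x).+1]].
Proof.
pose walk x n := exists p, [/\ size p = n, path e r p & last r p = x].
pose walkb x n := `[< walk x n >].
have walkP x : connect e r x -> exists n, walkb x n.
  by case/connectP=> p ep ->; exists (size p); apply/asboolP; exists p.
pose d x := if pselect (exists n, walkb x n) is left w then ex_minn w else 0.
have dmin x n : walk x n -> d x <= n.
  move=> /asboolP wxn; rewrite /d; case: pselect => [w|[]]; last by exists n.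
  by case: ex_minnP => m _; apply.
have dwalk x : connect e r x -> walk x (d x).
  move=> /walkP w; rewrite /d; case: pselect => [{}w|//].
  by case: ex_minnP => m /asboolP.
have walk_connect x n : walk x n -> connect e r x.
  by case=> p [_ ep <-]; apply/connectP; exists p.
have walkS x y n : walk x n -> e x y -> walk y n.+1.
  case=> p [<- ep <-] xy; exists (rcons p y).
  by rewrite size_rcons rcons_path last_rcons ep.
exists d; split.
- by apply/eqP; rewrite -leqn0; apply: dmin; exists [::].
- by move=> x y /dwalk wx xy; apply: dmin; apply: walkS xy.
move=> y ry yr; have [p] := dwalk _ ry; case/lastP: p => [|p z].
  by case=> _ _ yE; rewrite -yE eqxx in yr.
rewrite size_rcons rcons_path last_rcons => -[dy /andP[ep pz] zy].
move: pz; rewrite {z}zy => pz.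
have wp : walk (last r p) (size p) by exists p.
exists (last r p); split=> //; first exact: walk_connect wp.
apply/eqP; rewrite eqn_leq; apply/andP; split.
  by apply: dmin; apply: walkS pz; apply/dwalk/walk_connect/wp.
by rewrite -dy ltnS dmin.
Qed.

Definition colorable_on (G : sgraph) (U : pred G) (k : nat) : Prop :=
  exists f : G -> 'I_k, forall x y, U x -> U y -> sedge x y -> f x != f y.

Definition clique_minor_on (G : sgraph) (U : pred G) (n : nat) : Prop :=
  exists B : 'I_n -> {set G},
    [/\ forall i x, x \in B i -> U x,
        forall i, connected_in (B i),
        forall i j, i != j -> [disjoint B i & B j] &
        forall i j, i != j ->
          exists u v, [/\ u \in B i, v \in B j & sedge u v]].

Lemma chromatic_number_le (G : sgraph) k :
  colorable G k -> chromatic_number G <= k.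
Proof.
by move=> Gk; rewrite /chromatic_number; case: ex_minnP => m _; apply; apply/asboolP.
Qed.

Lemma chromatic_numberP (G : sgraph) : colorable G (chromatic_number G).
Proof. by rewrite /chromatic_number; case: ex_minnP => m /asboolP. Qed.

(** Used for layer parity with a colour, for the side of a 2-dicolouring with a class, and for
    pairing up [2 * t] branch sets. *)
Lemma pair_code k : exists h : bool * 'I_k -> 'I_(2 * k), injective h.
Proof.
have card2k : #|{: bool * 'I_k}| = 2 * k by rewrite card_prod card_bool card_ord.
exists (fun p => cast_ord card2k (enum_rank p)) => p q.
by move=> /cast_ord_inj/enum_rank_inj.
Qed.

Lemma connected_to_root (G : sgraph) (A : {set G}) (r : G) :
    r \in A ->
    (forall x, x \in A -> connect (restrict (mem A) (@sedge G)) r x) ->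
  connected_in A.
Proof.
move=> rA Ar; split; first by apply/set0Pn; exists r.
have sym : connect_sym (restrict (mem A) (@sedge G)).
  by apply: sym_connect_sym => a b; rewrite /restrict sedge_sym andbCA.
by move=> x y xA yA; apply: (connect_trans _ (Ar _ yA)); rewrite sym; apply: Ar.
Qed.

(** If every layer had a [k]-colouring, adding the parity of the layer would colour [U] with [2 * k]
    colours. So some layer has a minor with [n] branch sets, and the ball of closer vertices, in
    which every vertex of the layer has a neighbour, is one more. *)
Lemma clique_minor_step (G : sgraph) (U : pred G) n k :
    0 < k ->
    (forall V : pred G, ~ colorable_on V k -> clique_minor_on V n) ->
  ~ colorable_on U (2 * k) -> clique_minor_on U n.+1.
Proof.
move=> k0 IH Uk; pose e := restrict U (@sedge G).
have sym : connect_sym e.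
  by apply: sym_connect_sym => a b; rewrite /e /restrict sedge_sym andbCA.
have [d dP] := choice (distance_exists e).
pose layer (p : G * nat) : pred G :=
  fun x => [&& U x, connect e p.1 x & d p.1 x == p.2].
have [[r i] rik] : exists p, ~ colorable_on (layer p) k.
  apply: contra_notP Uk => /forallNP lk.
  have {}lk p : exists f : G -> 'I_k, forall x y,
      layer p x -> layer p y -> sedge x y -> f x != f y.
    exact: contrapT (lk p).
  have {lk}[c cP] := choice lk.
  have [h h_inj] := pair_code k.
  (* Each component is measured from its canonical representative, so adjacent vertices share a root
     and their distances differ by at most one. *)
  pose rt x := fingraph.root e x.
  exists (fun x => h (odd (d (rt x) x), c (rt x, d (rt x) x) x)) => x y Ux Uy xy.
  have exy : e x y by apply/and3P.
  have eyx : e y x by rewrite /e /restrict sedge_sym andbCA.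
  have rtxy : rt x = rt y by apply/fingraph.rootP => //; apply: connect1.
  have rx : connect e (rt x) x by rewrite sym connect_root.
  have ry : connect e (rt x) y by rewrite rtxy sym connect_root.
  rewrite (inj_eq h_inj) -rtxy xpair_eqE negb_and.
  have [_ dle _] := dP (rt x).
  have dy := dle _ _ rx exy; have dx := dle _ _ ry eyx.
  have [dE|dN] := eqVneq (d (rt x) x) (d (rt x) y).
    apply/orP; right; rewrite -dE; apply: cP xy; rewrite /layer /= ?Ux ?rx ?eqxx //.
    by rewrite Uy ry dE eqxx.
  apply/orP; left; have [dS|dS] : d (rt x) y = (d (rt x) x).+1 \/
    d (rt x) x = (d (rt x) y).+1 by lia.
    by rewrite dS /=; case: odd.
  by rewrite dS /=; case: odd.
have [B [BU Bc Bd Be]] := IH _ rik.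
have [d0 _ dpred] := dP r.
have d0P x : connect e r x -> d r x = 0 -> x = r.
  move=> rx dx; apply/eqP; apply: contraT => /(dpred _ rx)[z [_ _]].
  by rewrite dx.
(* Layer [0] contains at most [r], so one colour suffices; hence the layer has index [i.+1]. *)
case: i => [|i] in rik BU *.
  case: rik; exists (fun=> Ordinal k0) => x y /and3P[_ rx /eqP dx] /and3P[_ ry /eqP dy].
  by rewrite (d0P _ rx dx) (d0P _ ry dy) sedge_irrefl.
have Ur : U r.
  apply: contra_notT rik => Ur; exists (fun=> Ordinal k0) => x y /and3P[_ /= rx /eqP dx].
  suff xr : x = r by rewrite xr d0 in dx.
  apply: (connect_invariant (P := fun z => z = r)) rx _ => // a b /and3P[Ua _ _] ar.
  by rewrite -ar Ua in Ur.
pose A : {set G} := [set x | connect e r x && (d r x <= i)]%SET.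
have AU x : x \in A -> U x.
  rewrite inE => /andP[rx _]; apply: (connect_invariant (P := U)) rx Ur.
  by move=> a b /and3P[].
have rA : r \in A by rewrite inE connect0 d0.
have Ac : connected_in A.
  apply: (connected_to_root rA) => x xA.
  have [m] := ubnP (d r x); elim: m x xA => // m IHm x xA dm.
  have [->|xr] := eqVneq x r; first exact: connect0.
  move: (xA); rewrite inE => /andP[rx dx].
  have [z [rz zx dz]] := dpred _ rx xr.
  have zA : z \in A by rewrite inE rz /=; lia.
  apply: connect_trans (IHm z zA _) _; first by lia.
  by apply: connect1; rewrite /restrict /= zA xA; case/and3P: zx.
have AB j : [disjoint A & B j].
  apply/pred0P => x /=; apply/negbTE/negP => /andP[]; rewrite inE => /andP[_ dx] /BU.
  by case/and3P=> _ _ /= /eqP dx'; rewrite dx' ltnn in dx.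
have Aedge j : exists u v, [/\ u \in A, v \in B j & sedge u v].
  have [/set0Pn[v vB] _] := Bc j.
  have /and3P[Uv /= rv /eqP dv] := BU _ _ vB.
  have vr : v != r by apply: contra_eq_neq dv => ->; rewrite d0.
  have [u [ru /and3P[_ _ uv] du]] := dpred _ rv vr.
  by exists u, v; split=> //; rewrite inE ru /=; lia.
exists (fun j => if unlift ord0 j is Some j' then B j' else A); split.
- by move=> j x; case: unliftP => [j' _ /BU/and3P[]//|_ /AU].
- by move=> j; case: unliftP.
- move=> j l; case: unliftP => [j' ->|->]; case: unliftP => [l' ->|->] //.
  + by rewrite (inj_eq lift_inj); apply: Bd.
  + by rewrite disjoint_sym.
- move=> j l; case: unliftP => [j' ->|->]; case: unliftP => [l' ->|->] //.
  + by rewrite (inj_eq lift_inj); apply: Be.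
  + by have [u [v [uA vB uv]]] := Aedge j'; exists v, u; split; rewrite // sedge_sym.
Qed.

Lemma clique_minor_of_not_colorable (G : sgraph) (U : pred G) n :
  ~ colorable_on U (2 ^ n) -> clique_minor_on U n.
Proof.
elim: n U => [|n IHn] U; first by move=> _; exists (fun=> finset.set0); split; case.
by rewrite expnS; apply: clique_minor_step => //; rewrite expn_gt0.
Qed.

(** A crude bound: it shows that some forcing number exists, so [m_chi] is a true minimum and not
    the default value [0]. *)
Lemma forces_minor_pow2 t : forces_minor t (2 ^ t).+1.
Proof.
move=> G chi; have [|B [_ Bc Bd Be]] :=
    @clique_minor_of_not_colorable G xpredT t; last by exists B; split.
case=> f fP; move: chi; rewrite ltnNge => /negP; apply.
apply: chromatic_number_le; exists [ffun x => f x] => x y xy.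
by rewrite !ffunE fP.
Qed.

Lemma least_positive_exists (P : nat -> Prop) m :
  0 < m -> P m -> exists2 k, least_positive P k & k <= m.
Proof.
move=> m0 Pm; pose Q k := (0 < k) && `[< P k >].
have Qm : Q m by rewrite /Q m0; apply/asboolP.
have exQ : exists k, Q k by exists m.
case: (ex_minnP exQ) => k /andP[k0 /asboolP Pk] kmin; exists k; last exact: kmin.
by split=> // l l0 Pl; apply: kmin; rewrite /Q l0; apply/asboolP.
Qed.

Lemma xget_least_positive (P : nat -> Prop) m :
  least_positive P m -> xget 0 (least_positive P) = m.
Proof.
case=> m0 Pm mmin; case: xgetP => [k _ [k0 Pk kmin]|/(_ m)[]//].
by apply/eqP; rewrite eqn_leq mmin ?kmin.
Qed.

Lemma m_chiP t : 0 < m_chi t /\ forces_minor t (m_chi t).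
Proof.
have [m mP _] := least_positive_exists (ltn0Sn _) (@forces_minor_pow2 t).
by rewrite /m_chi (xget_least_positive mP); case: mP.
Qed.

(** * Strongly connected 2-dicolourable sets *)

Definition strong_in (D : digraph) (A : pred D) : Prop :=
  forall x y, A x -> A y -> connect (restrict A (@darc D)) x y.

(* A rank that increases along every monochromatic arc certifies that both
   colour classes are acyclic. *)
Definition two_dicolorable (D : digraph) (A : pred D) : Prop :=
  exists (c : D -> bool) (r : D -> nat),
    forall x y, A x -> A y -> darc x y -> c x = c y -> r x < r y.

Lemma connect_restrict_sub (T : finType) (A B : pred T) (e : rel T) x y :
    (forall z, A z -> B z) ->
  connect (restrict A e) x y -> connect (restrict B e) x y.
Proof.
move=> AB; apply: connect_sub => a b /and3P[/AB Ba /AB Bb ab].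
by apply: connect1; apply/and3P.
Qed.

Lemma strong_in_root (D : digraph) (A : pred D) (a : D) :
    (forall x, A x -> connect (restrict A (@darc D)) a x) ->
    (forall x, A x -> connect (restrict A (@darc D)) x a) ->
  strong_in A.
Proof. by move=> aA Aa x y Ax Ay; apply: connect_trans (Aa _ Ax) (aA _ Ay). Qed.

Lemma two_dicolorable_sub (D : digraph) (A B : pred D) :
  (forall x, A x -> B x) -> two_dicolorable B -> two_dicolorable A.
Proof. by move=> AB [c [r cr]]; exists c, r => x y /AB Bx /AB By; apply: cr. Qed.

Lemma bounded_rank (T : finType) (r : T -> nat) : exists M, forall x, r x <= M.
Proof. by exists (\max_x r x) => x; apply: leq_bigmax. Qed.

(** * A maximal strong set [X] and a union [W] of later parts not adjacent to it *)

Section MaximalStrongSet.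
Variables (D : digraph) (X W : pred D).
Hypothesis XW : forall x, X x -> ~~ W x.
Hypothesis X_strong : strong_in X.
Hypothesis X_dic : two_dicolorable X.
Hypothesis X_max : forall Y : pred D,
  (forall x, X x -> Y x) -> (forall y, Y y -> X y || W y) ->
  strong_in Y -> two_dicolorable Y -> forall y, Y y -> X y.
Hypothesis XW_nonadj : forall x w x',
  X x -> W w -> X x' -> darc x w -> ~~ darc w x'.

(** Positions are given by a function on [nat], so that a shortcut is a reindexing. *)
Let detour (p : nat -> D) (l : nat) :=
  [/\ forall i, i <= l -> W (p i),
      forall i, i < l -> darc (p i) (p i.+1),
      exists2 x, X x & darc x (p 0) &
      exists2 x, X x & darc (p l) x].

(* A shortest detour of [l.+1] vertices, coloured alternately, could be added
   to X. *)
Lemma no_detour p l : ~ detour p l.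
Proof.
move=> pl; have exl : exists l, `[< exists p, detour p l >].
  by exists l; apply/asboolP; exists p.
case: (ex_minnP exl) => {exl pl p}l /asboolP[p [pW pp [a Xa ap] [b Xb pb]]] lmin.
have {}lmin q k : detour q k -> l <= k.
  by move=> qk; apply: lmin; apply/asboolP; exists q.
have l0 : 0 < l.
  rewrite lt0n; apply/eqP => l0; rewrite l0 in pb.
  by move: (XW_nonadj Xa (pW 0 (leq0n _)) Xb ap); rewrite pb.
have pX i : i <= l -> ~~ X (p i) by move=> /pW; apply: contraL => /XW.
(* The next three claims are shortcut arguments: an arc from [X] into a later vertex, one into [X]
   from an earlier vertex, or a jump ahead would give a shorter detour. *)
have in_head x j : j <= l -> X x -> darc x (p j) -> j = 0.
  move=> jl Xx xj; suff: l <= l - j by lia.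
  apply: (lmin (fun i => p (i + j))); split; last by rewrite subnK //; exists b.
  - by move=> i il; apply: pW; lia.
  - by move=> i il; apply: pp; lia.
  - by exists x.
have out_last x i : i <= l -> X x -> darc (p i) x -> i = l.
  move=> il Xx ix; suff: l <= i by lia.
  apply: (lmin p); split; [| |by exists a|by exists x].
  - by move=> j ji; apply: pW; lia.
  - by move=> j ji; apply: pp; lia.
have no_jump i j : j <= l -> darc (p i) (p j) -> j <= i.+1.
  move=> jl ij; rewrite leqNgt; apply/negP => lt_ij.
  suff: l <= l - (j - i.+1) by lia.
  pose q k := if k <= i then p k else p (k + (j - i.+1)).
  apply: (lmin q); split.
  - by move=> k kl; rewrite /q; case: ifP => _; apply: pW; lia.
  - move=> k kl; rewrite /q; case: (ltngtP k i) => [ki|ki|->].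
    + by apply: pp; lia.
    + by rewrite addSn; apply: pp; lia.
    + by rewrite (_ : i.+1 + _ = j) //; lia.
  - by exists a.
  - exists b => //; rewrite /q ifF; last by lia.
    by rewrite subnK //; lia.
pose s := mkseq p l.+1; pose idx x := index x s.
have sP x : x \in s -> idx x <= l /\ p (idx x) = x.
  move=> xs; have: idx x < size s by rewrite index_mem.
  rewrite size_mkseq => xl; split; first by lia.
  by rewrite -[RHS](nth_index x xs) nth_mkseq.
have ps i : i <= l -> p i \in s.
  by move=> il; apply/mapP; exists i; rewrite // mem_iota; lia.
(* If [X] together with the detour is strong and 2-dicolourable, maximality puts [p 0] into [X], a
   contradiction. *)
pose Y : pred D := fun x => X x || (x \in s).
suff: X (p 0) by rewrite (negbTE (pX 0 _)).
apply: (@X_max Y); rewrite /Y ?ps ?orbT //.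
- by move=> x ->.
- by move=> x /orP[->//|/sP[xl <-]]; rewrite pW ?orbT.
- pose f := restrict Y (@darc D).
  have XY x : X x -> Y x by rewrite /Y => ->.
  have psY i : i <= l -> Y (p i) by move=> il; rewrite /Y ps ?orbT.
  have ap_connect i : i <= l -> connect f a (p i).
    elim: i => [|i IHi] il.
      by apply: connect1; apply/and3P; split; [exact: XY|exact: psY|].
    apply: connect_trans (IHi (ltnW il)) _.
    by apply: connect1; apply/and3P; split; [exact/psY/ltnW|exact: psY|exact: pp].
  have pb_connect i : i <= l -> connect f (p (l - i)) b.
    elim: i => [|i IHi] il.
      by rewrite subn0; apply: connect1; apply/and3P; split; [exact: psY|exact: XY|].
    apply: connect_trans (IHi (ltnW il)); apply: connect1; apply/and3P.
    split; [by apply: psY; lia|by apply: psY; lia|].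
    by rewrite (_ : l - i = (l - i.+1).+1); [apply: pp|]; lia.
  have X_connect x y : X x -> X y -> connect f x y.
    by move=> Xx Xy; apply: connect_restrict_sub (X_strong Xx Xy).
  apply: (@strong_in_root _ _ a) => x /orP[Xx|/sP[xl <-]].
  + exact: X_connect.
  + exact: ap_connect.
  + exact: X_connect.
  + rewrite -(subKn xl); apply: connect_trans (pb_connect _ _) _; first by lia.
    exact: X_connect.
have [c [r cr]] := X_dic; have [M rM] := bounded_rank r.
(* Parity alternates along the detour, so monochromatic arcs between its vertices go backwards.
   Ranks therefore fall with the index and lie below [X], except that [p 0], the only vertex entered
   from [X], lies above it. *)
exists (fun y => if X y then c y else odd (idx y)).
exists (fun y => if X y then l.+1 + r y
  else if idx y == 0 then l.+2 + M else l - idx y).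
move=> x y /orP Yx /orP Yy xy.
have notX z : X z \/ z \in s -> X z = false -> idx z <= l /\ p (idx z) = z.
  by case=> [->//|/sP].
case: ifP => Xx; case: ifP => Xy /=.
- by move=> /(cr _ _ Xx Xy xy); lia.
- move=> _; have [yl yE] := notX _ Yy Xy.
  rewrite (in_head x (idx y)) ?yE //=.
  by have := rM x; lia.
- move=> _; have [xl xE] := notX _ Yx Xx.
  have xlE : idx x = l by apply: (out_last y); rewrite ?xE.
  by rewrite xlE ifF; lia.
- have [xl xE] := notX _ Yx Xx; have [yl yE] := notX _ Yy Xy.
  have := no_jump (idx x) (idx y) yl; rewrite xE yE => /(_ xy) jump odd_eq.
  have ne1 : idx y <> (idx x).+1.
    by move=> e; move: odd_eq; rewrite e /=; case: odd.
  have ne : idx y <> idx x.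
    by move=> e; move: xy; rewrite -xE -yE e darc_irrefl.
  have -> : (idx x == 0) = false by lia.
  by case: ifP => _; lia.
Qed.

(** Both colourings are kept and the ranks are stacked: lowest the vertices of [W] not reached from
    [X] through [W], then [X], then the reached ones [R]. An arc descending between levels would
    either go from [R] to [X], closing a detour, or make an unreached vertex reached. *)
Lemma two_dicolorable_union :
  two_dicolorable W -> two_dicolorable (fun x => X x || W x).
Proof.
move=> [cW [rW crW]]; have [cX [rX crX]] := X_dic.
have [MW leW] := bounded_rank rW; have [MX leX] := bounded_rank rX.
pose R w := [exists x, exists v, [&& X x, W v, darc x v & connect (restrict W (@darc D)) v w]].
have RX w x : R w -> X x -> ~~ darc w x.
  case/existsP=> a /existsP[v /and4P[Xa Wv av /connectP[p vp wE]]] Xx.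
  apply/negP => wx; apply: (@no_detour (nth v (v :: p)) (size p)).
  have vp' := pathP v vp; split.
  - by case=> [//|i] ip; have /and3P[_ Wi _] := vp' i ip.
  - by move=> i ip; have /and3P[_ _ ii] := vp' i ip.
  - by exists a.
  - by exists x => //; rewrite nth_last /= -wE.
exists (fun x => if X x then cX x else cW x).
exists (fun x => if X x then MW.+1 + rX x
  else if R x then MW.+1 + MX.+1 + rW x else rW x).
move=> x y; case: ifP => Xx; case: ifP => Xy //=.
- by move=> _ _ xy cxy; have := crX _ _ Xx Xy xy cxy; lia.
- move=> _ Wy xy _; rewrite ifT; first by have := leX x; lia.
  by apply/existsP; exists x; apply/existsP; exists y; rewrite Xx Wy xy connect0.
- move=> Wx _ xy _; rewrite ifF; first by have := leW x; lia.
  by apply: contraTF xy => Rx; apply: RX Rx Xy.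
- move=> Wx Wy xy cxy; have := crW _ _ Wx Wy xy cxy.
  have Rxy : R x -> R y.
    case/existsP=> a /existsP[v /and4P[Xa Wv av vx]].
    apply/existsP; exists a; apply/existsP; exists v; rewrite Xa Wv av /=.
    by apply: connect_trans vx _; apply: connect1; apply/and3P.
  case: (boolP (R x)) => [/Rxy ->|_]; first by lia.
  by case: ifP => _; lia.
Qed.

End MaximalStrongSet.

(** * Partition into strong parts, and the graph of parts *)

Definition crosses (D : digraph) (U : {set D}) (g : D -> nat) (i j : nat) : bool :=
  [exists x in U, exists y in U, [&& g x == i, g y == j & darc x y]].

Lemma crossesP (D : digraph) (U : {set D}) (g : D -> nat) i j :
  reflect (exists x y, [/\ x \in U, y \in U, g x = i, g y = j & darc x y])
          (crosses U g i j).
Proof.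
apply: (iffP idP).
  case/existsP=> x /andP[xU /existsP[y /and4P[yU /eqP gx /eqP gy xy]]].
  by exists x, y.
case=> x [y [xU yU <- <- xy]].
by apply/existsP; exists x; rewrite xU; apply/existsP; exists y; rewrite yU !eqxx.
Qed.

(** Induction on the size of [U]: a maximal strong 2-dicolourable subset [X] is removed and receives
    the label [n], just above those of the remaining parts. If [I] selects [n], then [X] is added to
    the union [W] of the other selected parts, which is 2-dicolourable by induction. *)
Lemma strong_partition (D : digraph) (U : {set D}) :
  exists (n : nat) (g : D -> nat),
    [/\ forall x, x \in U -> g x < n,
        forall i, i < n -> strong_in (fun x => (x \in U) && (g x == i)) &
        forall I : pred nat,
          (forall i j, I i -> I j -> i != j -> ~~ (crosses U g i j && crosses U g j i)) ->
        two_dicolorable (fun x => (x \in U) && I (g x))].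
Proof.
have [m] := ubnP #|U|; elim: m U => // m IHm U Um.
have [->|/set0Pn[u uU]] := eqVneq U finset.set0.
  exists 0, (fun=> 0); split=> // [x|I _]; first by rewrite inE.
  by exists xpredT, (fun=> 0) => x y; rewrite inE.
pose P (A : {set D}) := [&& A \subset U, A != finset.set0 &
  `[< strong_in (mem A) /\ two_dicolorable (mem A) >]].
have [|X /maxsetP[/and3P[XU Xn0 /asboolP[Xs Xd]] Xmax]] := @ex_maxset _ P.
  exists [set u]%SET; apply/and3P; split.
  - by rewrite finset.sub1set.
  - by apply/set0Pn; exists u; rewrite inE.
  apply/asboolP; split.
    by move=> x y /=; rewrite !inE => /eqP-> /eqP->; apply: connect0.
  exists xpredT, (fun=> 0) => x y /=; rewrite !inE => /eqP-> /eqP->.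
  by rewrite darc_irrefl.
have XsubU x : x \in X -> x \in U by apply: (fintype.subsetP XU).
have UXm : #|(U :\: X)%SET| < m.
  rewrite ltnS in Um; have /set0Pn[x xX] := Xn0.
  apply: leq_trans Um; apply: proper_card.
  apply/properP; split; first exact: finset.subsetDl.
  exists x; first exact: XsubU. by rewrite !inE xX.
have [n [g [gn gstrong gdic]]] := IHm _ UXm.
pose h x := if x \in X then n else g x.
have hX x : x \in X -> h x = n by rewrite /h => ->.
have hNX x : x \notin X -> h x = g x by rewrite /h => /negbTE ->.
have fiberX x : (x \in U) && (h x == n) = (x \in X).
  have [xX|xX] := boolP (x \in X); first by rewrite hX // (XsubU _) //= eqxx.
  apply/negbTE/negP => /andP[xU /eqP]; rewrite hNX // => gx.
  by have := gn x; rewrite !inE xX xU gx ltnn => /(_ isT).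
have fiber i x : i < n ->
    (x \in U) && (h x == i) = (x \in (U :\: X)%SET) && (g x == i).
  move=> i_n; rewrite !inE; have [xX|xX] := boolP (x \in X); last by rewrite hNX.
  by rewrite hX // (gtn_eqF i_n) andbF.
exists n.+1, h; split.
- move=> x xU; have [xX|xX] := boolP (x \in X); first by rewrite hX.
  by rewrite hNX // ltnW // ltnS gn // !inE xX.
- move=> i; rewrite ltnS leq_eqVlt => /orP[/eqP->|i_n].
    by rewrite (_ : (fun _ => _) = mem X) //; apply/funext => x; rewrite fiberX.
  rewrite (_ : (fun _ => _) = (fun x => (x \in (U :\: X)%SET) && (g x == i))).
    exact: gstrong.
  by apply/funext => x; rewrite fiber.
move=> I Iindep; pose W : pred D := fun x => (x \in (U :\: X)%SET) && I (g x).
have Wd : two_dicolorable W.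
  apply: gdic => i j Ii Ij ij; apply: contra (Iindep i j Ii Ij ij).
  have up a b : crosses (U :\: X)%SET g a b -> crosses U h a b.
    case/crossesP=> x [y [/finset.setDP[xU xX] /finset.setDP[yU yX] gx gy xy]].
    by apply/crossesP; exists x, y; split; rewrite ?hNX.
  by case/andP=> /up -> /up ->.
have [In|NIn] := boolP (I n); last first.
  apply: two_dicolorable_sub Wd => x /andP[xU]; rewrite /W !inE xU.
  have [xX|xX] := boolP (x \in X); first by rewrite hX // (negbTE NIn).
  by rewrite hNX.
apply: (@two_dicolorable_sub _ _ (fun x => (x \in X) || W x)).
  move=> x /andP[xU]; rewrite /W !inE xU.
  by have [//|xX] := boolP (x \in X); rewrite hNX.
apply: (two_dicolorable_union (X := mem X)) => //.
- by move=> x /= xX; rewrite /W !inE xX.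
- move=> Y XY YW Ys Yd y Yy; pose A : {set D} := [set y | Y y]%SET.
  have AE : (mem A : pred D) = Y by apply/funext => z /=; rewrite inE.
  suff AX : A = X by rewrite -AX /= inE.
  apply: Xmax; last by apply/fintype.subsetP => z zX; rewrite inE XY.
  apply/and3P; split.
  + apply/fintype.subsetP => z; rewrite inE => /YW /orP[/XsubU//|].
    by rewrite /W !inE => /andP[/andP[]].
  + by apply/set0Pn; exists y; rewrite inE.
  + by apply/asboolP; rewrite AE.
(* Arcs from [X] to [w] and from [w] back would make part [n] and the part of [w] cross in both
   directions. *)
- move=> x w x' xX Ww x'X xw; apply/negP => wx'.
  move: Ww; rewrite /W => /andP[wUX Iw]; have gw := gn _ wUX.
  move: wUX; rewrite !inE => /andP[wX wU].
  have /negP := Iindep n (g w) In Iw (negbT (gtn_eqF gw)); apply; apply/andP; split.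
  + by apply/crossesP; exists x, w; split; [exact: XsubU| |exact: hX|exact: hNX|].
  + by apply/crossesP; exists w, x'; split; [|exact: XsubU|exact: hNX|exact: hX|].
Qed.

Lemma dicolorable_of_rank (D : digraph) k (f : D -> 'I_k) (r : D -> nat) :
    (forall x y, darc x y -> f x = f y -> r x < r y) ->
  dicolorable D k.
Proof.
move=> fr; exists [ffun x => f x] => i [//|x p] /andP[/= xp _].
suff: r (val x) < r (val x) by rewrite ltnn.
have : path ltn (r (val x)) (map (r \o val) (rcons p x)).
  rewrite path_map; apply: sub_path xp => a b ab; apply: fr => //.
  have := valP a; have := valP b.
  by rewrite !inE !ffunE => /eqP -> /eqP ->.
move/(order_path_min ltn_trans)/allP; apply.
by apply/mapP; exists x; rewrite // mem_rcons mem_head.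
Qed.

Lemma dichromatic_number_le (D : digraph) k :
  dicolorable D k -> dichromatic_number D <= k.
Proof.
by move=> Dk; rewrite /dichromatic_number; case: ex_minnP => m _; apply; apply/asboolP.
Qed.

(** Suppose the graph of parts had [k < m] colours. Each colour class is 2-dicolourable, so [D]
    would have a dicolouring with [2 * k < 2 * m - 1] colours. Hence the graph has a clique minor,
    and the union of the parts in a branch set is strong because every edge can be crossed in either
    direction. *)
Lemma complete_strong_minor (D : digraph) n m :
    0 < m -> forces_minor n m -> 2 * m - 1 <= dichromatic_number D ->
  exists S : 'I_n -> {set D},
    [/\ forall i, strong_in (mem (S i)),
        forall i j, i != j -> [disjoint S i & S j] &
        forall i j, i != j -> exists x y, [/\ x \in S i, y \in S j & darc x y]].
Proof.
move=> m0 mP Dm; have [N [g [gN gstrong gdic]]] := strong_partition [set: D]%SET.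
have {}gN x : g x < N by apply: gN; rewrite inE.
pose part x : 'I_N := Ordinal (gN x).
pose link : rel 'I_N := fun i j =>
  [&& i != j, crosses [set: D]%SET g i j & crosses [set: D]%SET g j i].
have link_sym : symmetric link.
  by move=> i j; rewrite /link eq_sym; congr (_ && _); apply: andbC.
have link_irrefl : irreflexive link by move=> i; rewrite /link eqxx.
pose G := SGraph link_sym link_irrefl.
have mG : m <= chromatic_number G.
  rewrite leqNgt; apply/negP => Gm; set k := chromatic_number G in Gm.
  have [f fP] := chromatic_numberP G.
  pose I (c : 'I_k) : pred nat :=
    fun i => if insub i is Some i' then f (i' : 'I_N) == c else false.
  have Idic c : exists q : (D -> bool) * (D -> nat), forall x y,
      (x \in [set: D]%SET) && I c (g x) -> (y \in [set: D]%SET) && I c (g y) ->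
      darc x y -> q.1 x = q.1 y -> q.2 x < q.2 y.
    have [|a [r arP]] := gdic (I c); last by exists (a, r).
    move=> i j; rewrite /I; case: insubP => // i' _ <- /eqP fi.
    case: insubP => // j' _ <- /eqP fj ij; apply/negP => ijc.
    have : @sedge G i' j' by rewrite /= /link -val_eqE /= ij.
    by move/fP; rewrite fi fj eqxx.
  have [q qP] := choice Idic; have [h h_inj] := pair_code k.
  suff /dichromatic_number_le : dicolorable D (2 * k) by lia.
  apply: (@dicolorable_of_rank _ _
    (fun x => h ((q (f (part x))).1 x, f (part x))) (fun x => (q (f (part x))).2 x)).
  move=> x y xy /h_inj[qxy fxy]; move: qxy; rewrite -fxy => qxy.
  have Ipart z : I (f (part z)) (g z).
    rewrite /I; case: insubP => [i _ gi|]; last by rewrite gN.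
    by rewrite (_ : part z = i) ?eqxx //; apply: val_inj.
  by apply: qP => //; rewrite inE //= fxy Ipart.
have [B [Bc Bd Be]] := mP G mG.
exists (fun i => [set x | part x \in B i]%SET).
split.
- move=> i x y /=; rewrite !inE => xB yB; set A := mem _.
  have fib a z w : a \in B i -> part z = a -> part w = a ->
      connect (restrict A (@darc D)) z w.
    move=> aB za wa; have := @gstrong a (ltn_ord a) z w.
    rewrite !inE /= -[g z]/(val (part z)) -[g w]/(val (part w)) za wa eqxx.
    move=> /(_ isT isT); apply: connect_restrict_sub => v.
    rewrite !inE /= => /eqP va; rewrite (_ : part v = a) //; exact: val_inj.
  have [_ /(_ _ _ xB yB)] := Bc i.
  (* Carried along a path of parts: every vertex of the current part is reachable from [x] inside
     the union. *)
  move=> /(@connect_invariant _ _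
     (fun a => forall z, part z = a -> connect (restrict A (@darc D)) x z)); apply=> //.
    move=> a b /and3P[aB bB /and3P[_ /crossesP[u [v [_ _ gu gv uv]]] _]] IH z zb.
    have ua : part u = a by apply: val_inj.
    have vb : part v = b by apply: val_inj.
    apply: connect_trans (IH _ ua) _; apply: connect_trans (fib b v z bB vb zb).
    by apply: connect1; rewrite /restrict /A /= !inE ua vb aB bB.
  by move=> z zx; apply: (fib (part x)).
- move=> i j ij; apply/pred0P => x /=; rewrite !inE.
  apply/negbTE/negP => /andP[xi xj]; have /pred0P/(_ (part x)) := Bd i j ij.
  by rewrite /= xi xj.
- move=> i j ij; have [a [b [aB bB /and3P[_ /crossesP[x [y [_ _ gx gy xy]]] _]]]] := Be i j ij.
  have xa : part x = a by apply: val_inj.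
  have yb : part y = b by apply: val_inj.
  by exists x, y; rewrite !inE xa yb.
Qed.

(** * From in-trees and out-trees to butterfly minors *)

(** Undirected, since the in-tree and the out-tree with the same label are joined by a one-way arc
    and a label class is only weakly connected. *)
Definition linked (T : finType) (L : eqType) (e : rel T) (l : T -> option L) : rel T :=
  fun x y => [&& l x != None, l x == l y & e x y || e y x].

(* [l] assigns vertices to the vertices of the complete digraph, or to nothing.
   Vertices in [I] form the in-trees still to be contracted into their roots
   and those in [O] the out-trees: a vertex of [I] has at most one out-neighbour,
   and a vertex of [O] at most one in-neighbour. *)
Record tree_model (T : finType) (t : nat) (e : rel T) (l : T -> option 'I_t)
    (I O : pred T) : Prop := TreeModel {
  tm_disjoint : forall x, I x -> ~~ O x;
  tm_noIO : forall x y, I x -> e x y -> ~~ O y;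
  tm_out : forall x y y', I x -> e x y -> e x y' -> y = y';
  tm_in : forall x x' y, O y -> e x y -> e x' y -> x = x';
  tm_inner : forall x y, e x y -> l x = l y -> I x || O y;
  tm_connect : forall x y, l x != None -> l x = l y -> connect (linked e l) x y;
  tm_arc : forall i j, i != j ->
    exists x y, [/\ l x = Some i, l y = Some j & e x y];
  tm_surj : forall i, exists x, l x = Some i }.

Lemma linked_sym (T : finType) (L : eqType) (e : rel T) (l : T -> option L) :
  symmetric (linked e l).
Proof.
move=> x y; rewrite /linked (eq_sym (l x) (l y)) [e x y || _]orbC.
by have [->|_] := eqVneq (l y) (l x); rewrite /= ?andbF.
Qed.

(** Exchanges in-trees and out-trees, so that contraction is worked out only for an arc leaving a
    vertex of [I]. *)
Lemma tree_model_rev (T : finType) t (e : rel T) (l : T -> option 'I_t) I O :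
  tree_model e l I O -> tree_model (fun x y => e y x) l O I.
Proof.
case=> dj noIO out inn inner con arc surj; split=> //.
- by move=> x; apply: contraL => /dj.
- by move=> x y Ox yx; apply: contraL Ox => Iy; apply: noIO yx.
- by move=> x y y' Ox; apply: inn.
- by move=> x x' y Iy; apply: out.
- by move=> x y yx lxy; rewrite orbC; apply: inner.
- move=> x y lx lxy; rewrite (@eq_connect _ _ (linked e l)); first exact: con.
  by move=> a b; rewrite /linked orbC.
- by move=> i j ij; have [|x [y [lx ly xy]]] := arc j i; [rewrite eq_sym|exists y, x].
Qed.

(** The merged vertex inherits the role of [v]. As [v] is the only out-neighbour of [u], it gains
    only in-arcs from [u], which is harmless because [v] is not in [O]. *)
Lemma tree_model_collapse (T T' : finType) t (e : rel T) (e' : rel T')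
    (l : T -> option 'I_t) (I O : pred T) (m : T -> T') (s : T' -> T) (u v : T) :
    I u -> e u v -> l u = l v ->
    cancel s m -> (forall a, s (m a) = if a == u then v else a) ->
    (forall x y, e' x y <-> x != y /\ exists a b, [/\ m a = x, m b = y & e a b]) ->
  tree_model e l I O -> tree_model e' (l \o s) (I \o s) (O \o s).
Proof.
move=> Iu uv luv sK ms e'P [dj noIO out inn inner con arc surj].
have muv : m u = m v by rewrite -[LHS]sK ms eqxx.
have lsm a : l (s (m a)) = l a by rewrite ms; case: eqP => // ->.
(* A surviving arc starts at the representative of [x]: starting at [u] it would end at [v] and
   become a loop. *)
have arcP x y : e' x y -> exists b, [/\ m b = y, e (s x) b & s y = if b == u then v else b].
  case/e'P=> xy [a [b [ax yb ab]]]; exists b; rewrite -{2}yb ms; split=> //.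
  rewrite -ax ms; case: eqP => // au; move: xy; rewrite -ax -yb au muv.
  by rewrite (out u b v) ?eqxx -?au // ?au.
split=> /=.
- by move=> x; apply: dj.
- move=> x y Ix /arcP[b [_ xb ->]]; case: eqP => _; first exact: noIO uv.
  exact: noIO xb.
- by move=> x y y' Ix /arcP[b [<- xb _]] /arcP[b' [<- xb' _]]; rewrite (out _ _ _ Ix xb xb').
- move=> x x' y Oy /arcP[b [_ xb yb]] /arcP[b' [_ xb' yb']].
  have Ov : ~~ O v by apply: noIO uv.
  move: yb yb' Oy; case: eqP => [_ ->|_ yb]; first by rewrite (negbTE Ov).
  case: eqP => [_ ->|_ yb' Oy]; first by rewrite (negbTE Ov).
  by rewrite -[x]sK -[x']sK; congr m; apply: inn Oy _ _; [rewrite yb|rewrite yb'].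
- move=> x y /arcP[b [_ xb yb]]; move: (yb) => ->; case: eqP => [bu|_]; last exact: inner.
  by rewrite -luv -bu => /(inner _ _ xb)/orP[->//|]; rewrite bu (negbTE (dj _ Iu)).
- move=> x y lx lxy; rewrite -[x]sK -[y]sK.
  apply: (connect_homo (e := linked e l)); last exact: con.
  move=> a b /and3P[la lab ab]; have [->|mab] := eqVneq (m a) (m b); first exact: connect0.
  apply: connect1; rewrite /linked /= !lsm la lab /=.
  case/orP: ab => ab; apply/orP; [left|right]; apply/e'P; split; rewrite // 1?eq_sym //.
  + by exists a, b.
  + by exists b, a.
- move=> i j ij; have [a [b [la lb ab]]] := arc i j ij; exists (m a), (m b).
  rewrite /= !lsm; split=> //; apply/e'P; split; last by exists a, b.
  by apply: contra_neq ij => mab; apply: Some_inj; rewrite -la -lb -[l a]lsm mab lsm.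
- by move=> i; have [x lx] := surj i; exists (m x); rewrite /= lsm.
Qed.

Lemma tree_model_del_vertex (D : digraph) t (e : rel D) (l : D -> option 'I_t)
    (I O : pred D) (v : D) :
    l v = None -> tree_model e l I O ->
  tree_model (T := del_vertex v) (fun x y => e (val x) (val y)) (l \o val)
    (I \o val) (O \o val).
Proof.
move=> lv [dj noIO out inn inner con arc surj].
have lift x : l x != None -> exists x' : del_vertex v, val x' = x.
  move=> lx; suff xv : x \in [set~ v]%SET by exists (exist _ x xv).
  by rewrite !inE; apply: contra_neq lx => ->.
split=> /=.
- by move=> x; apply: dj.
- by move=> x y; apply: noIO.
- by move=> x y y' Ix xy xy'; apply: val_inj; apply: out xy xy'.
- by move=> x x' y Oy xy x'y; apply: val_inj; apply: inn xy x'y.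
- by move=> x y; apply: inner.
- move=> x y lx lxy; rewrite -[x](valKd x) -[y](valKd x).
  apply: (connect_homo (e := linked e l)); last exact: con.
  move=> a b /and3P[la /eqP lab ab]; have [|b' bE] := lift b; first by rewrite -lab.
  have [a' aE] := lift a la; rewrite -aE -bE !valKd; apply: connect1.
  by rewrite /linked /= aE bE la lab eqxx.
- move=> i j ij; have [x [y [lx ly xy]]] := arc i j ij.
  have [|x' xE] := lift x; first by rewrite lx.
  have [|y' yE] := lift y; first by rewrite ly.
  by exists x', y'; rewrite xE yE.
- move=> i; have [x lx] := surj i; have [|x' xE] := lift x; first by rewrite lx.
  by exists x'; rewrite xE.
Qed.

Lemma tree_model_contract (D : digraph) t (l : D -> option 'I_t) (I O : pred D) (u v : D) :
    tree_model (@darc D) l I O -> darc u v -> l u = l v ->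
  exists (l' : Defs.contract u v -> option 'I_t) (I' O' : pred (Defs.contract u v)),
    tree_model (@darc (Defs.contract u v)) l' I' O'.
Proof.
move=> DM uv luv; have uNv : u != v by apply: contraTneq uv => ->; rewrite darc_irrefl.
have mP a : Defs.merge u v a \in [set~ v]%SET.
  by rewrite /Defs.merge !inE; case: ifP => // ->.
pose m a : Defs.contract u v := exist _ (Defs.merge u v a) (mP a).
have mE a x : (m a == x) = (Defs.merge u v a == val x) by rewrite -val_eqE.
have contractP (x y : Defs.contract u v) :
    darc x y <-> x != y /\ exists a b, [/\ m a = x, m b = y & darc a b].
  split=> [/andP[xy /existsP[a /existsP[b /and3P[ax b_y ab]]]]|[xy [a [b [ax b_y ab]]]]].
    by split=> //; exists a, b; split=> //; apply/eqP; rewrite mE.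
  apply/andP; split=> //; apply/existsP; exists a; apply/existsP; exists b.
  by rewrite -!mE ax b_y !eqxx.
have valNv (x : Defs.contract u v) : (val x == v) = false.
  by have := valP x; rewrite !inE => /negbTE.
have [Iu|Ov] := orP (tm_inner DM uv luv).
  pose s (x : Defs.contract u v) := if val x == u then v else val x.
  exists (l \o s), (I \o s), (O \o s).
  apply: (tree_model_collapse (m := m) Iu uv luv) contractP DM => [x|a].
    apply/eqP; rewrite mE /s /Defs.merge; case: (eqVneq (val x) u) => [xu|xu].
      by rewrite eqxx xu.
    by rewrite valNv.
  rewrite /s /= /Defs.merge; case: (eqVneq a v) => [->|av].
    by rewrite eqxx; case: ifP.
  by case: ifP.
(* If [v] lies in [O], the same argument runs on the reversed arcs, the merged vertex now taking the
   role of [u]. *)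
exists (l \o val), (I \o val), (O \o val).
apply: (@tree_model_rev _ _ (fun x y => @darc (Defs.contract u v) y x)).
apply: (tree_model_collapse (m := m) (e := fun x y => darc y x) (u := v) (v := u)) => //.
- by move=> x; apply/eqP; rewrite mE /Defs.merge valNv.
- move=> x y; split=> [yx|[xy [a [b [ax b_y ab]]]]].
    by have [xy [a [b [ax b_y ab]]]] := (contractP y x).1 yx; rewrite eq_sym; split=> //; exists b, a.
  by apply/(contractP y x); rewrite eq_sym; split=> //; exists b, a.
- exact: tree_model_rev.
Qed.

(** Induction on the number of vertices, then on the number of arcs outside [e]. Spare arcs and
    unlabelled vertices are deleted, and arcs within a label class are contracted, which [tm_inner],
    [tm_out] and [tm_in] permit. When none is left, each connected class is a single vertex and the
    labels give an isomorphism. *)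
Lemma tree_model_butterfly_minor (D : digraph) t (e : rel D) (l : D -> option 'I_t)
    (I O : pred D) :
  (forall x y, e x y -> darc x y) -> tree_model e l I O ->
  butterfly_minor (complete_digraph t) D.
Proof.
have [n] := ubnP #|D|; elim: n D e l I O => // n IHn D e l I O Dn.
pose spare (F : digraph) (e : rel F) := [set p : F * F | darc p.1 p.2 && ~~ e p.1 p.2]%SET.
have [k] := ubnP #|spare D e|.
elim: k D e l I O Dn => // k IHk D e l I O Dn Dk eD DM.
have [/existsP[[u v] /andP[uv euv]]|/existsPn eE] :=
    boolP [exists p : D * D, darc p.1 p.2 && ~~ e p.1 p.2].
  apply: (BM_del_arc uv); apply: (IHk (del_arc u v) e l I O Dn _ _ DM).
    rewrite ltnS in Dk; apply: leq_trans Dk; apply: proper_card.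
    apply/properP; split.
      by apply/fintype.subsetP => -[x y]; rewrite !inE /= /del_arc_rel => /andP[/andP[-> _] ->].
    exists (u, v); first by rewrite inE uv.
    by rewrite inE /= /del_arc_rel eqxx andbF.
  move=> x y xy; rewrite /= /del_arc_rel eD //=.
  by apply: contraNneq euv => -[<- <-].
have {}eE : e = @darc D.
  apply/funext => x; apply/funext => y; apply/idP/idP => [/eD//|xy].
  by have := eE (x, y); rewrite /= xy /= negbK.
rewrite eE in DM; move=> {Dk IHk eE eD e}.
have card_del v : #|{: {x : D | x \in [set~ v]%SET}}| < n.
  rewrite card_sig; apply: leq_trans (Dn : #|D| <= n); apply: proper_card.
  by apply/properP; split; [exact/fintype.subsetP|exists v; rewrite // !inE eqxx].
have [/existsP[v /eqP lv]|/existsPn lE] := boolP [exists v, l v == None].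
  apply: (@BM_del_vertex _ _ v); by apply: IHn (tree_model_del_vertex lv DM) => //; apply: card_del.
have [/existsP[[u v] /andP[uv /eqP luv]]|/existsPn noinner] :=
    boolP [exists p : D * D, darc p.1 p.2 && (l p.1 == l p.2)].
  apply: (@BM_contract _ _ u v).
    rewrite /contractible uv /=; apply/orP.
    have [Iu|Ov] := orP (tm_inner DM uv luv); [left|right]; apply/forallP => w; apply/implyP => uw.
      by rewrite (tm_out DM Iu uw uv).
    by rewrite (tm_in DM Ov uw uv).
  have [l' [J [K DM']]] := tree_model_contract DM uv luv.
  by apply: IHn DM' => //; apply: card_del.
have l_inj : injective l.
  move=> x y lxy; apply: (connect_invariant (P := eq x)) (tm_connect DM (lE x) lxy) _ => //.
  move=> a b /and3P[_ lab ab] _; case/orP: ab => ab.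
    by have := noinner (a, b); rewrite /= ab lab.
  by have := noinner (b, a); rewrite /= ab eq_sym lab.
have lSome x : exists i, l x = Some i.
  by have := lE x; case: (l x) => // i _; exists i.
have [f fE] := choice lSome.
have [g gE] := choice (tm_surj DM).
apply: BM_iso; exists f.
  exists g => [x|i]; first by apply: l_inj; rewrite gE fE.
  by apply: Some_inj; rewrite -fE gE.
move=> x y /=; apply/idP/idP => [/(tm_arc DM)[x' [y' [lx ly]]]|].
  have -> : x' = x by apply: l_inj; rewrite lx fE.
  by have -> : y' = y by apply: l_inj; rewrite ly fE.
move=> xy; apply: contraTneq xy => fxy; have -> : x = y by apply: l_inj; rewrite !fE fxy.
by rewrite darc_irrefl.
Qed.

(** [p.1] is the parent and [p.2] the depth in a breadth-first tree; the falling depth later drives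
    an induction towards the root. *)
Lemma out_tree (T : finType) (e : rel T) (a : T) :
  exists p : (T -> T) * (T -> nat), forall x, connect e a x -> x != a ->
    [/\ e (p.1 x) x, connect e a (p.1 x) & p.2 (p.1 x) < p.2 x].
Proof.
have [d [_ _ dpred]] := distance_exists e a.
have pred x : exists z, connect e a x -> x != a ->
    [/\ connect e a z, e z x & d x = (d z).+1].
  have [ax|] := boolP (connect e a x); last by exists x.
  have [->|xa] := eqVneq x a; first by exists a.
  by have [z zP] := dpred x ax xa; exists z.
have [pi piP] := choice pred.
by exists (pi, d) => x ax xa /=; have [? ? ->] := piP x ax xa; split.
Qed.

Lemma in_tree (T : finType) (e : rel T) (a : T) :
  exists p : (T -> T) * (T -> nat), forall x, connect e x a -> x != a ->
    [/\ e x (p.1 x), connect e (p.1 x) a & p.2 (p.1 x) < p.2 x].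
Proof.
have [p pP] := out_tree (fun x y => e y x) a.
exists p => x xa; move: (connect_rev e a x) (connect_rev e a (p.1 x)) (pP x).
by rewrite /= => -> ->; apply.
Qed.

(** [S (true, i)] carries the in-tree and [S (false, i)] the out-tree of label [i]. Kept arcs
    between labels run from an out-tree to an in-tree, so they add neither out-arcs to in-trees nor
    in-arcs to out-trees. *)
Lemma butterfly_minor_of_strong_sets (D : digraph) t (S : bool * 'I_t -> {set D}) :
    (forall p, strong_in (mem (S p))) ->
    (forall p q, p != q -> [disjoint S p & S q]) ->
    (forall p q, p != q -> exists x y, [/\ x \in S p, y \in S q & darc x y]) ->
  butterfly_minor (complete_digraph t) D.
Proof.
move=> Ss Sd Se.
have root_ex i : exists ab : D * D,
    [/\ ab.1 \in S (true, i), ab.2 \in S (false, i) & darc ab.1 ab.2].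
  by have [|a [b abP]] := Se (true, i) (false, i); [|exists (a, b)].
have [ab abP] := choice root_ex.
pose a i := (ab i).1; pose b i := (ab i).2.
have [aS bS abD] : [/\ forall i, a i \in S (true, i), forall i, b i \in S (false, i) &
    forall i, darc (a i) (b i)] by split=> i; case: (abP i).
have [pin pinP] := choice (fun i => in_tree (restrict (mem (S (true, i))) (@darc D)) (a i)).
have [pout poutP] := choice (fun i => out_tree (restrict (mem (S (false, i))) (@darc D)) (b i)).
pose k x := [pick p | x \in S p].
have kP p x : x \in S p <-> k x = Some p.
  rewrite /k; case: pickP => [q xq|noq]; last by split=> //; rewrite noq.
  split=> [xp|[<-]//]; congr Some; apply/eqP; apply: contraT => qp.
  by have /pred0P/(_ x) := Sd q p qp; rewrite /= xq xp.
pose l x := omap snd (k x).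
(* [I] contains the root [a i], whose kept out-arc goes to [b i]; [O] leaves out [b i], since no
   kept arc may lead from [I] to [O]. *)
pose I x := if k x is Some (true, _) then true else false.
pose O x := if k x is Some (false, i) then x != b i else false.
(* One function for both trees: the out-neighbour of a vertex of [I], the in-neighbour of a vertex
   of [O]. *)
pose par x := match k x with
  | Some (true, i) => if x == a i then b i else (pin i).1 x
  | Some (false, i) => (pout i).1 x
  | None => x
  end.
pose crossing x y := match k x, k y with
  | Some (false, i), Some (true, j) => (i != j) && darc x y
  | _, _ => false
  end.
pose e x y := [|| I x && (y == par x), O y && (x == par y) | crossing x y].
have IP x : I x -> exists i, k x = Some (true, i).
  by rewrite /I; case: (k x) => [[[] i]|] // _; exists i.
have OP x : O x -> exists2 i, k x = Some (false, i) & x != b i.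
  by rewrite /O; case: (k x) => [[[] i]|] // xb; exists i.
have parI x i : k x = Some (true, i) ->
    darc x (par x) /\ (x = a i /\ par x = b i \/
      [/\ x != a i, k (par x) = Some (true, i) & (pin i).2 (par x) < (pin i).2 x]).
  move=> kx; rewrite /par kx; have xS := (kP _ _).2 kx.
  case: eqVneq => [->|xa]; first by split=> //; left.
  have [||/and3P[_ yS xy] _ lt] := pinP i x => //; first exact: Ss xS (aS i).
  by split=> //; right; split=> //; apply/kP.
have parO y i : k y = Some (false, i) -> y != b i ->
    [/\ darc (par y) y, k (par y) = Some (false, i) & (pout i).2 (par y) < (pout i).2 y].
  move=> ky yb; rewrite /par ky; have yS := (kP _ _).2 ky.
  have [||/and3P[xS _ xy] _ lt] := poutP i y => //; first exact: Ss (bS i) yS.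
  by split=> //; apply/kP.
have kb i : k (b i) = Some (false, i) by apply/kP.
have crossP x y : crossing x y -> exists i j,
    [/\ k x = Some (false, i), k y = Some (true, j), i != j & darc x y].
  rewrite /crossing; case: (k x) => [[[] i]|] //; case: (k y) => [[[] j]|] //.
  by case/andP=> ij xy; exists i, j.
have INO x : I x -> ~~ O x by move=> /IP[i kx]; rewrite /O kx.
have parIO x : I x -> ~~ O (par x).
  case/IP=> i /parI[_ [[_ ->]|[_ kpx _]]]; first by rewrite /O kb eqxx.
  by rewrite /O kpx.
have ON x y : O y -> x = par y -> ~~ I x.
  by move=> /OP[i ky yb] ->; have [_ kp _] := parO _ _ ky yb; rewrite /I kp.
have eI x y : I x -> e x y -> y = par x.
  move=> Ix /or3P[/andP[_ /eqP]//|/andP[Oy /eqP xE]|].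
    by move: Ix; rewrite (negbTE (ON _ _ Oy xE)).
  by case/crossP=> i [j [kx _ _ _]]; move: Ix; rewrite /I kx.
have eO x y : O y -> e x y -> x = par y.
  move=> Oy /or3P[/andP[Ix /eqP yE]|/andP[_ /eqP]//|].
    by move: Oy; rewrite yE (negbTE (parIO _ Ix)).
  by case/crossP=> i [j [_ ky _ _]]; move: Oy; rewrite /O ky.
apply: (@tree_model_butterfly_minor D t e l I O).
  move=> x y /or3P[/andP[/IP[i kx] /eqP->]|/andP[/OP[i ky yb] /eqP->]|].
  - by case: (parI _ _ kx).
  - by case: (parO _ _ ky yb).
  - by case/crossP=> i [j []].
(* Following parents links every vertex of label [i] to [b i], by way of [a i] from the in-tree. *)
have to_b i x : l x = Some i -> connect (linked e l) x (b i).
  have lb : l (b i) = Some i by rewrite /l kb.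
  rewrite {1}/l; case kx : (k x) => [[[] j]|] //= [ji]; rewrite {j}ji in kx *.
  - have [n] := ubnP ((pin i).2 x); elim: n x kx => // n IHn x kx xn.
    have xpar : l (par x) = Some i -> linked e l x (par x).
      by move=> lp; rewrite /linked lp /l kx eqxx /= /e /I kx eqxx.
    have [_ [[xa px]|[xa kp lt]]] := parI _ _ kx.
      by rewrite -px; apply: connect1; apply: xpar; rewrite px.
    apply: connect_trans (IHn _ kp _); last by lia.
    by apply: connect1; apply: xpar; rewrite /l kp.
  - have [n] := ubnP ((pout i).2 x); elim: n x kx => // n IHn x kx xn.
    have [->|xb] := eqVneq x (b i); first exact: connect0.
    have [_ kp lt] := parO _ _ kx xb.
    apply: connect_trans (IHn _ kp _); last by lia.
    apply: connect1; rewrite /linked /l kx kp eqxx /= orbC.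
    have Ox : O x by rewrite /O kx.
    by rewrite /e Ox eqxx orbT.
split=> //.
- by move=> x y Ix /(eI _ _ Ix) ->; apply: parIO.
- by move=> x y y' Ix /(eI _ _ Ix) -> /(eI _ _ Ix).
- by move=> x x' y Oy /(eO _ _ Oy) -> /(eO _ _ Oy).
- move=> x y /or3P[/andP[-> //]|/andP[-> _]|]; first by rewrite orbT.
  case/crossP=> i [j [kx ky ij _]]; rewrite /l kx ky => -[ijE].
  by rewrite ijE eqxx in ij.
- move=> x y; case lx : (l x) => [i|] // _ ly.
  apply: connect_trans (to_b i x lx) _.
  by rewrite (sym_connect_sym (@linked_sym _ _ e l)); apply: to_b.
- move=> i j ij; have [|x [y [/kP kx /kP ky xy]]] := Se (false, i) (true, j) => //.
  exists x, y; rewrite /l kx ky; split=> //; apply/or3P; apply: Or33.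
  by rewrite /crossing kx ky ij.
- by move=> i; exists (b i); rewrite /l kb.
Qed.

(** * The explicit bound and its growth *)

Lemma forces_butterfly_minor_m_chi t :
  forces_butterfly_minor t (2 * m_chi (2 * t) - 1).
Proof.
move=> D Dm; have [m0 mP] := m_chiP (2 * t).
have [S [Ss Sd Se]] := complete_strong_minor m0 mP Dm.
have [h h_inj] := pair_code t.
apply: (@butterfly_minor_of_strong_sets _ _ (S \o h)) => [p|p q pq|p q pq] /=.
- exact: Ss.
- by apply: Sd; rewrite (inj_eq h_inj).
- by apply: Se; rewrite (inj_eq h_inj).
Qed.

Lemma bm_dichi_le t :
  (exists b, least_positive (forces_butterfly_minor t) b) /\
  bm_dichi t <= 2 * m_chi (2 * t) - 1.
Proof.
have [m0 _] := m_chiP (2 * t).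
have [|b bP b_le] := least_positive_exists _ (@forces_butterfly_minor_m_chi t).
  by lia.
by split; [exists b|rewrite /bm_dichi (xget_least_positive bP)].
Qed.

Import Order.TTheory GRing.Theory Num.Theory.

Local Open Scope classical_set_scope.
Local Open Scope ring_scope.

(** The threshold gives [2 <= ln x], so [ln 2 <= ln (ln x)], and the factor [2] in
    [ln (2 * x) <= 2 * ln x] costs at most another [ln (ln x)]. *)
Lemma lnln_double (R : realType) (x : R) :
  expR 2 <= x -> 0 <= ln (ln (2 * x)) <= 2 * ln (ln x).
Proof.
move=> ex; have e2 : 3 <= expR 2 :> R by have := expR_ge1Dx (2 : R); lra.
have x0 : 0 < x by lra.
have L2 : 2 <= ln x.
  by rewrite -[leLHS](expRK (2 : R)) ler_ln ?posrE ?expR_gt0.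
have ln2x : ln (2 * x) = ln 2 + ln x by rewrite lnM ?posrE //; lra.
have ln2_ge0 : 0 <= ln 2 :> R by apply: ln_ge0; lra.
have ln2L : ln 2 <= ln x by rewrite ler_ln ?posrE //; lra.
have ln2lnL : ln 2 <= ln (ln x) by rewrite ler_ln ?posrE //; lra.
apply/andP; split; first by apply: ln_ge0; lra.
apply: (@le_trans _ _ (ln (2 * ln x))); first by rewrite ler_ln ?posrE; lra.
by rewrite lnM ?posrE //; lra.
Qed.

Lemma bigO_double (R : realType) (m : nat -> nat) :
  ((fun t : nat => (m t)%:R : R) : nat -> R^o) =O_\oo
     ((fun t : nat => t%:R * ln (ln t%:R) ^+ 6 : R) : nat -> R^o) ->
  ((fun t : nat => (2 * m (2 * t) - 1)%N%:R : R) : nat -> R^o) =O_\oo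
     ((fun t : nat => t%:R * ln (ln t%:R) ^+ 6 : R) : nat -> R^o).
Proof.
move=> /eqO_exP[k k0 [N _ mk]]; apply/eqO_exP.
have [M _ Me] := nbhs_infty_ger (expR 2 : R).
(* [256] is [2 * 2 * 2 ^ 6]: the outer doubling, the factor in [2 * t], and the sixth power of the
   doubled iterated logarithm. *)
exists (256 * k); first by rewrite mulr_gt0.
exists (maxn N M) => // t /=; rewrite geq_max => /andP[Nt Mt].
have : `|(m (2 * t)%N)%:R : R^o| <= k * `|(2 * t)%:R * ln (ln (2 * t)%:R) ^+ 6 : R^o| by apply: mk => /=; lia.
have /lnln_double/andP[l0 l2] := Me t Mt.
rewrite natrM; set x : R := t%:R in l0 l2 *.
have x0 : 0 <= x by rewrite ler0n.
have p0 : 0 <= ln (ln (2 * x)) ^+ 6 by rewrite exprn_ge0.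
have p2 : ln (ln (2 * x)) ^+ 6 <= 64 * ln (ln x) ^+ 6.
  rewrite (_ : 64 = 2 ^+ 6); last by rewrite -natrX.
  by rewrite -exprMn lerXn2r ?nnegrE //; lra.
rewrite !normr_nat ger0_norm; last by rewrite mulr_ge0 // mulr_ge0.
rewrite ger0_norm; last by rewrite mulr_ge0 //; lra.
move=> mle; apply: (@le_trans _ _ (2 * (m (2 * t)%N)%:R)).
  by rewrite -natrM ler_nat; lia.
have xp : x * ln (ln (2 * x)) ^+ 6 <= x * (64 * ln (ln x) ^+ 6) by rewrite ler_wpM2l.
have := ler_wpM2l (ltW k0) xp; lra.
Qed.

(** Postle's bound on [m_chi] enters as the premise of the second half. *)
Theorem corollary1 (R : realType) :
  (forall t : nat, (1 <= t)%N ->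
     (exists b : nat, least_positive (forces_butterfly_minor t) b) /\
     (bm_dichi t <= 2 * m_chi (2 * t) - 1)%N) /\
  (((fun t : nat => (m_chi t)%:R : R) : nat -> R^o) =O_\oo
     ((fun t : nat => t%:R * ln (ln t%:R) ^+ 6 : R) : nat -> R^o) ->
   ((fun t : nat => (2 * m_chi (2 * t) - 1)%N%:R : R) : nat -> R^o) =O_\oo
     ((fun t : nat => t%:R * ln (ln t%:R) ^+ 6 : R) : nat -> R^o)).
Proof. by split=> [t _|]; [apply: bm_dichi_le|apply: bigO_double]. Qed.
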